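(* Let $R$ be a ring. The following statements are equivalent. 1. The ring $R$ is a weakly left localizable ring such that (a) $\mathfrak{l}_R=0$, (b) $|\mathrm{max.Den}_l(R)|<\infty$, (c) for every $S\in \mathrm{max.Den}_l(R)$, $S^{-1}R$ is a weakly left localizable ring, and (d) for all $S,T\in \mathrm{max.Den}_l(R)$ such that $S\neq T$, $\mathrm{ass}(S)$ is not a nil ideal modulo $\mathrm{ass}(T)$. 2. $Q_{l,cl}(R)$ exists and $Q_{l,cl}(R)\simeq \prod_{i=1}^n R_i$ for some $n\geq 1$, where the $R_i$ are local rings with $\mathrm{rad}(R_i)=\mathcal{N}_{R_i}$. 3. $Q_l(R)\simeq \prod_{i=1}^n R_i$ for some $n\geq 1$, where the $R_i$ are local rings with $\mathrm{rad}(R_i)=\mathcal{N}_{R_i}$.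
   Context: All rings are associative with $1\neq 0$; ideals are two-sided. For a ring $R$: $R^*$ is the group of units, $\mathcal{C}_R$ is the set of (left and right) regular elements, i.e. non-zero-divisors, $\mathrm{rad}(R)$ is the Jacobson radical, $\mathrm{Nil}(R)$ is the set of nilpotent elements, and $\mathcal{N}_R$ is the nil radical, i.e. the sum of all nil ideals of $R$. A ring $R$ is local if $R\setminus R^*$ is an ideal of $R$ (equivalently, $R/\mathrm{rad}(R)$ is a division ring). A subset $S\subseteq R$ closed under multiplication with $1\in S$, $0\notin S$ is a left Ore set if $Sr\cap Rs\neq\emptyset$ for all $r\in R$, $s\in S$; then $\mathrm{ass}(S):=\{r\in R: sr=0\text{ for some }s\in S\}$ is an ideal. A left Ore set $S$ is a left denominator set if $rs=0$ with $r\in R$, $s\in S$ implies $tr=0$ for some $t\in S$. For a left denominator set $S$, $S^{-1}R=\{s^{-1}r: s\in S,r\in R\}$ is the left localization of $R$ at $S$; the kernel of $R\to S^{-1}R$, $r\mapsto \frac r1$, is $\mathrm{ass}(S)$. $\mathrm{Den}_l(R)$ is the set of left denominator sets of $R$, and $\mathrm{max.Den}_l(R)$ is the (non-empty) set of its maximal elements with respect to inclusion. $\mathfrak{l}_R:=\bigcap_{S\in \mathrm{max.Den}_l(R)}\mathrm{ass}(S)$ is the left localization radical of $R$. $Q_{l,cl}(R):=\mathcal{C}_R^{-1}R$ is the classical left quotient ring; it exists iff $\mathcal{C}_R$ is a left Ore set. There is a largest left denominator set $S_{l,0}(R)$ among those with $\mathrm{ass}=0$ (equivalently, the largest left Ore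 set consisting of regular elements), and $Q_l(R):=S_{l,0}(R)^{-1}R$ is the largest left quotient ring of $R$. An element of $R$ is left localizable if it belongs to some left denominator set of $R$. The ring $R$ is weakly left localizable if every non-nilpotent element of $R$ is left localizable. For ideals $\mathfrak a,\mathfrak b$ of $R$, ''$\mathfrak a$ is a nil ideal modulo $\mathfrak b$'' means that $(\mathfrak a+\mathfrak b)/\mathfrak b$ is a nil ideal of $R/\mathfrak b$. *)

(* Defs.v *)
From HB Require Import structures.
From mathcomp Require Import all_boot all_order all_algebra.
From mathcomp Require Import generic_quotient.
From mathcomp Require Import boolp classical_sets functions cardinality.

Set Implicit Arguments.
Unset Strict Implicit.
Unset Printing Implicit Defensive.

Import GRing.Theory.
Local Open Scope quotient_scope.
Local Open Scope classical_set_scope.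
Local Open Scope ring_scope.

Section BasicNotions.
Variable R : nzRingType.
Implicit Types (S T I : set R) (x y r s : R).

Definition invertible x := exists y, x * y = 1 /\ y * x = 1.

Definition regular_elements : set R :=
  [set s | forall r, (s * r = 0 -> r = 0) /\ (r * s = 0 -> r = 0)].

Definition nilpotent x := exists n, x ^+ n = 0.

Definition left_ideal I :=
  [/\ I 0, forall x y, I x -> I y -> I (x - y) & forall r x, I x -> I (r * x)].

Definition ideal I := left_ideal I /\ (forall x r, I x -> I (x * r)).

Definition nil_ideal I := ideal I /\ (forall x, I x -> nilpotent x).

Definition maximal_left_ideal I :=
  [/\ left_ideal I, I != setT &
      forall J : set R, left_ideal J -> I `<=` J -> J != setT -> J = I].

Definition jacobson_radical : set R := \bigcap_(I in maximal_left_ideal) I.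

Definition nil_radical : set R :=
  [set x | exists n (a : 'I_n -> R),
     (forall i, exists2 I, nil_ideal I & I (a i)) /\ x = \sum_(i < n) a i].

Definition local_ring := ideal [set x | ~ invertible x].

(* (A + B) / B is nil in R / B : a coset (x + y) + B is nilpotent
   iff some power of x + y lies in B. *)
Definition nil_modulo (A B : set R) :=
  forall x y, A x -> B y -> exists n, B ((x + y) ^+ n).

Definition left_Ore S :=
  [/\ S 1, ~ S 0, forall s t, S s -> S t -> S (s * t) &
      forall r s, S s -> exists t q, S t /\ t * r = q * s].

Definition left_denominator S :=
  left_Ore S /\
  (forall r s, S s -> r * s = 0 -> exists2 t, S t & t * r = 0).

Definition ass S : set R := [set r | exists2 s, S s & s * r = 0].

Definition max_Den : set (set R) :=
  [set S | left_denominator S /\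
     forall T, left_denominator T -> S `<=` T -> T = S].

Definition left_localization_radical : set R :=
  \bigcap_(S in max_Den) ass S.

Definition left_localizable x := exists2 S, left_denominator S & S x.

Definition weakly_left_localizable :=
  forall x, ~ nilpotent x -> left_localizable x.

(* The union of all left denominator sets with zero assassinator; by
   [largest_regular_den_denominator], [ass_largest_regular_den] and
   [largest_regular_den_max] it is the largest of them. *)
Definition largest_regular_den : set R :=
  \bigcup_(S in [set S | left_denominator S /\ ass S = [set 0]]) S.

Lemma regular_left_Ore_denominator S :
  S `<=` regular_elements -> left_Ore S -> left_denominator S.
Proof.
move=> Sreg oreS; split=> // r s Ss rs0; exists 1; first by case: oreS.
by rewrite mul1r; apply: (Sreg s Ss r).2.
Qed.

Lemma regular_left_Ore_ass S :
  S `<=` regular_elements -> left_Ore S -> ass S = [set 0].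
Proof.
move=> Sreg [S1 _ _ _]; apply/seteqP; split=> r /=.
  by move=> [s /Sreg/(_ r)[sr _] /sr].
by move=> ->; exists 1; rewrite ?mulr0.
Qed.

Lemma ass0_regular S :
  left_denominator S -> ass S = [set 0] -> S `<=` regular_elements.
Proof.
move=> [_ denS] ass0 s Ss r.
have ass_eq0 q t : S t -> t * q = 0 -> q = 0.
  by move=> St tq; have : ass S q by [exists t]; rewrite ass0.
split; first exact: ass_eq0.
by move=> /denS-/(_ Ss)[t /ass_eq0]; apply.
Qed.

Lemma largest_regular_den_max S :
  left_denominator S -> ass S = [set 0] -> S `<=` largest_regular_den.
Proof. by move=> denS assS s Ss; exists S. Qed.

Lemma largest_regular_den_regular : largest_regular_den `<=` regular_elements.
Proof. by move=> s [S [denS assS] Ss]; apply: (ass0_regular denS). Qed.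

Lemma largest_regular_den_Ore : left_Ore largest_regular_den.
Proof.
set U := largest_regular_den.
pose M : set R := [set x | exists2 l : seq R,
  (forall s, s \in l -> U s) & x = \prod_(s <- l) s].
have UsubM : U `<=` M.
  by move=> s Us; exists [:: s]; rewrite ?big_seq1// => t; rewrite inE => /eqP->.
have Mreg : M `<=` regular_elements.
  move=> _ [l + ->]; elim: l => [_|s l IHl Ul] r.
    by rewrite big_nil mul1r mulr1.
  have Us : U s by apply: Ul; rewrite inE eqxx.
  have Ml t : t \in l -> U t by move=> tl; apply: Ul; rewrite inE tl orbT.
  have sreg := largest_regular_den_regular Us.
  rewrite big_cons; split.
    by rewrite -mulrA => /(sreg _).1 /(IHl Ml _).1.
  by rewrite mulrA => /(IHl Ml _).2 /(sreg _).2.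
have oreM : left_Ore M.
  split.
  - by exists [::]; rewrite ?big_nil.
  - move=> /Mreg/(_ 1)[+ _]; rewrite mul0r => /(_ erefl)/eqP.
    by rewrite oner_eq0.
  - move=> _ _ [l Ul ->] [k Uk ->]; exists (l ++ k); last by rewrite big_cat.
    by move=> s; rewrite mem_cat => /orP[/Ul|/Uk].
  - move=> r _ [l + ->]; elim/last_ind: l r => [|l s IHl] r Ul.
      exists 1, r; split; last by rewrite big_nil mul1r mulr1.
      by exists [::]; rewrite ?big_nil.
    have [S [denS assS] Ss] : U s by apply: Ul; rewrite mem_rcons inE eqxx.
    have [[_ _ _ oreS] _] := denS.
    have [t [q [St tr]]] := oreS r s Ss.
    have Ul' u : u \in l -> U u.
      by move=> ul; apply: Ul; rewrite mem_rcons inE ul orbT.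
    have [t' [q' [[k Uk ->] tq]]] := IHl q Ul'.
    exists ((\prod_(u <- k) u) * t), q'; split.
      exists (rcons k t); last by rewrite -cats1 big_cat big_seq1.
      move=> u; rewrite mem_rcons inE => /orP[/eqP->|/Uk//].
      by exists S.
    by rewrite -cats1 big_cat big_seq1 /= mulrA -tq -!mulrA tr.
suff -> : U = M by [].
apply/seteqP; split=> // x Mx.
apply: largest_regular_den_max Mx; first exact: regular_left_Ore_denominator.
exact: regular_left_Ore_ass.
Qed.

Lemma largest_regular_den_denominator : left_denominator largest_regular_den.
Proof.
exact: regular_left_Ore_denominator largest_regular_den_regular
  largest_regular_den_Ore.
Qed.

Lemma ass_largest_regular_den : ass largest_regular_den = [set 0].
Proof.
exact: regular_left_Ore_ass largest_regular_den_regular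
  largest_regular_den_Ore.
Qed.

End BasicNotions.

Arguments regular_elements R : clear implicits.
Arguments jacobson_radical R : clear implicits.
Arguments nil_radical R : clear implicits.
Arguments max_Den R : clear implicits.
Arguments left_localization_radical R : clear implicits.
Arguments largest_regular_den R : clear implicits.

Section LeftLocalization.
Variables (R : nzRingType) (S : set R) (denS : left_denominator S).

Let S1 : S 1. Proof. by case: denS => -[]. Qed.
Let S0 : ~ S 0. Proof. by case: denS => -[]. Qed.
Let SM s t : S s -> S t -> S (s * t). Proof. by case: denS => -[_ _ + _] _; apply. Qed.
Let Sore r s : S s -> exists t q, S t /\ t * r = q * s.
Proof. by case: denS => -[_ _ _ +] _; apply. Qed.
Let Sden r s : S s -> r * s = 0 -> exists2 t, S t & t * r = 0.
Proof. by case: denS => _; apply. Qed.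

Definition left_frac : Type := ({s : R | s \in S} * R)%type.
HB.instance Definition _ := Choice.on left_frac.

Definition num (x : left_frac) : R := x.2.
Definition den (x : left_frac) : R := sval x.1.

Lemma denP x : S (den x).
Proof. by apply: set_mem; case: x => -[]. Qed.

Definition mk_frac s (Ss : S s) r : left_frac := (exist _ s (mem_set Ss), r).

(* s^-1 r and s'^-1 r' agree iff they become identical over some common
   denominator c s = d s' in S. *)
Definition frac_equiv_prop (s r s' r' : R) :=
  exists c d, [/\ S (c * s), c * s = d * s' & c * r = d * r'].

Definition frac_equiv (x y : left_frac) : bool :=
  `[< frac_equiv_prop (den x) (num x) (den y) (num y) >].

Lemma frac_equiv_any s r s' r' c d : S s -> S s' ->
  frac_equiv_prop s r s' r' -> S (c * s) -> c * s = d * s' ->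
  exists2 t, S t & t * c * r = t * d * r'.
Proof.
move=> Ss Ss' [c0 [d0 [Sc0 cs0 cr0]]] Sc cs.
have [t [u [St tu]]] := Sore (c * s) Sc0.
have [v Sv v0] : exists2 v, S v & v * (t * c - u * c0) = 0.
  by apply: (Sden Ss); rewrite mulrBl -!mulrA tu subrr.
have [w Sw w0] : exists2 w, S w & w * (t * d - u * d0) = 0.
  by apply: (Sden Ss'); rewrite mulrBl -!mulrA -cs tu cs0 subrr.
have [a [b [Sa ab]]] := Sore v Sw.
exists (a * v * t); first by do 2?apply: SM.
have vc : v * t * c = v * u * c0.
  by apply/subr0_eq; rewrite -!mulrA -mulrBr.
have wd : w * t * d = w * u * d0.
  by apply/subr0_eq; rewrite -!mulrA -mulrBr.
transitivity (a * (v * t * c) * r); first by rewrite !mulrA.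
rewrite vc !mulrA ab -(mulrA _ c0) cr0 !mulrA.
transitivity (b * (w * u * d0) * r'); first by rewrite !mulrA.
by rewrite -wd !mulrA.
Qed.

Lemma frac_equiv_refl s r : S s -> frac_equiv_prop s r s r.
Proof. by move=> Ss; exists 1, 1; rewrite mul1r. Qed.

Lemma frac_equiv_sym s r s' r' :
  frac_equiv_prop s r s' r' -> frac_equiv_prop s' r' s r.
Proof. by move=> [c [d [Sc cs cr]]]; exists d, c; rewrite -cs. Qed.

Lemma frac_equiv_trans s1 r1 s2 r2 s3 r3 : S s1 -> S s2 -> S s3 ->
  frac_equiv_prop s1 r1 s2 r2 -> frac_equiv_prop s2 r2 s3 r3 ->
  frac_equiv_prop s1 r1 s3 r3.
Proof.
move=> Ss1 Ss2 Ss3 [c [d [Sc cs cr]]] e23; have [c' [d' [Sc' cs' cr']]] := e23.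
have [t [u [St tu]]] := Sore (c * s1) Sc'.
have e : t * d * s2 = u * d' * s3 by rewrite -!mulrA -cs tu cs'.
have Stds : S (t * d * s2) by rewrite -mulrA -cs; apply: SM.
have [v Sv ev] := frac_equiv_any Ss2 Ss3 e23 Stds e.
exists (v * (t * c)), (v * (u * d')); split.
- by rewrite -!mulrA; do 2?apply: SM.
- by rewrite -!mulrA cs (mulrA t) e !mulrA.
- by rewrite -mulrA -(mulrA t) cr !mulrA -(mulrA v t) ev !mulrA.
Qed.

Lemma frac_equiv_is_equiv : equiv_class_of frac_equiv.
Proof.
split=> [x|x y|y x z].
- by apply/asboolP; apply: frac_equiv_refl; apply: denP.
- by apply/asboolP/asboolP; apply: frac_equiv_sym.
- move=> /asboolP xy /asboolP yz; apply/asboolP.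
  by apply: frac_equiv_trans xy yz; apply: denP.
Qed.

Canonical frac_equiv_canonical := EquivRelPack frac_equiv_is_equiv.

Definition left_localization := {eq_quot frac_equiv}.
HB.instance Definition _ := Choice.on left_localization.
HB.instance Definition _ := EqQuotient.on left_localization.

Definition frac s (Ss : S s) r : left_localization :=
  \pi_left_localization (mk_frac Ss r).

Lemma frac_eq s r s' r' (Ss : S s) (Ss' : S s') :
  frac Ss r = frac Ss' r' <-> frac_equiv_prop s r s' r'.
Proof.
split; first by move/eqquotP/asboolP.
by move=> e; apply/eqquotP/asboolP.
Qed.

Lemma fracW (x : left_localization) : exists s (Ss : S s) r, x = frac Ss r.
Proof.
exists (den (repr x)), (denP (repr x)), (num (repr x)).
rewrite /frac -[LHS]reprK; congr (\pi _).
rewrite /mk_frac /den /num; case: (repr x) => -[s Ss] r /=.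
by congr (exist _ _ _, _); apply: bool_irrelevance.
Qed.

Lemma fracZ c s (Ss : S s) (Scs : S (c * s)) r : frac Scs (c * r) = frac Ss r.
Proof. by apply/frac_eq; exists 1, c; rewrite !mul1r. Qed.

Lemma frac_common (x y : left_localization) :
  exists s (Ss : S s) a b, x = frac Ss a /\ y = frac Ss b.
Proof.
have [s [Ss [r ->]]] := fracW x; have [s' [Ss' [r' ->]]] := fracW y.
have [t [q [St ts]]] := Sore s Ss'.
have Sts : S (t * s) by apply: SM.
have Sqs : S (q * s') by rewrite -ts.
exists (t * s), Sts, (t * r), (q * r'); split; first by rewrite fracZ.
rewrite -(fracZ Ss' Sqs); apply/frac_eq; exists 1, 1.
by rewrite !mul1r; split.
Qed.

Lemma frac_common3 (x y z : left_localization) :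
  exists s (Ss : S s) a b c, [/\ x = frac Ss a, y = frac Ss b & z = frac Ss c].
Proof.
have [s [Ss [a [b [-> ->]]]]] := frac_common x y.
have [s' [Ss' [r ->]]] := fracW z.
have [t [q [St ts]]] := Sore s Ss'.
have Sts : S (t * s) by apply: SM.
have Sqs : S (q * s') by rewrite -ts.
exists (t * s), Sts, (t * a), (t * b), (q * r); rewrite !fracZ; split=> //.
rewrite -(fracZ Ss' Sqs); apply/frac_eq; exists 1, 1.
by rewrite !mul1r; split.
Qed.

(* s^-1 a + s^-1 b = s^-1 (a + b), whatever the common denominator s. *)
Definition is_sum (x y z : left_localization) :=
  exists s (Ss : S s) a b, [/\ x = frac Ss a, y = frac Ss b & z = frac Ss (a + b)].

Lemma is_sum_ex x y : exists z, is_sum x y z.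
Proof.
have [s [Ss [a [b [-> ->]]]]] := frac_common x y.
by exists (frac Ss (a + b)), s, Ss, a, b.
Qed.

Lemma is_sum_uniq x y z z' : is_sum x y z -> is_sum x y z' -> z = z'.
Proof.
move=> [s [Ss [a [b [-> -> ->]]]]] [s' [Ss' [a' [b' [ea eb ->]]]]].
move/frac_eq: ea => [c [d [Sc cs ca]]]; move/frac_eq: eb => eb.
have [t St tb] := frac_equiv_any Ss Ss' eb Sc cs.
apply/frac_eq; exists (t * c), (t * d); split.
- by rewrite -mulrA; apply: SM.
- by rewrite -!mulrA cs.
- by rewrite !mulrDr tb -!mulrA ca.
Qed.

(* (s^-1 a) (u^-1 b) = (t s)^-1 (q b), where t a = q u with t in S. *)
Definition is_prod (x y z : left_localization) :=
  exists s (Ss : S s) a u (Su : S u) b t q (Sts : S (t * s)),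
    [/\ x = frac Ss a, y = frac Su b, S t, t * a = q * u
      & z = frac Sts (q * b)].

Lemma is_prod_ex x y : exists z, is_prod x y z.
Proof.
have [s [Ss [a ->]]] := fracW x; have [u [Su [b ->]]] := fracW y.
have [t [q [St tq]]] := Sore a Su.
by exists (frac (SM St Ss) (q * b)), s, Ss, a, u, Su, b, t, q, (SM St Ss).
Qed.

Lemma is_prod_uniq x y z z' : is_prod x y z -> is_prod x y z' -> z = z'.
Proof.
move=> [s1 [Ss1 [r1 [s2 [Ss2 [r2 [t [u [Sts [-> -> St tu ->]]]]]]]]]].
move=> [s3 [Ss3 [r3 [s4 [Ss4 [r4 [t' [u' [Sts' [+ + St' tu' ->]]]]]]]]]].
move=> /frac_eq e13 /frac_eq [c [d [Sc cs cr]]].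
have [p [q [Sp pq]]] := Sore (t * s1) Sts'.
have Spt : S (p * t * s1) by rewrite -mulrA; apply: SM.
have epq : p * t * s1 = q * t' * s3 by rewrite -!mulrA pq.
have [g Sg eg] := frac_equiv_any Ss1 Ss3 e13 Spt epq.
pose a := g * p; pose b := g * q.
have Sa : S a by apply: SM.
have eab : a * u * s2 = b * u' * s4.
  by rewrite /a /b -!mulrA -tu -tu' !mulrA -(mulrA g p) eg !mulrA.
have eab1 : a * (t * s1) = b * (t' * s3) by rewrite /a /b -!mulrA pq.
clearbody a b; have [e [f [Se ef]]] := Sore (a * u * s2) Sc.
have [v Sv v0] : exists2 v, S v & v * (e * (a * u) - f * c) = 0.
  by apply: (Sden Ss2); rewrite mulrBl -!mulrA !(mulrA a) ef subrr.
have [w Sw w0] : exists2 w, S w & w * (e * (b * u') - f * d) = 0.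
  by apply: (Sden Ss4); rewrite mulrBl -mulrA -eab ef cs mulrA subrr.
have [v' [w' [Sv' vw]]] := Sore v Sw.
have ev : v * (e * (a * u)) = v * (f * c).
  by apply/subr0_eq; rewrite -mulrBr.
have ew : w * (e * (b * u')) = w * (f * d).
  by apply/subr0_eq; rewrite -mulrBr.
have Sk : S (v' * v * e) by do 2?apply: SM.
apply/frac_eq; exists (v' * v * e * a), (v' * v * e * b); split.
- by rewrite -mulrA; apply: SM => //; apply: SM.
- by rewrite -!(mulrA (v' * v * e)) eab1.
- transitivity (v' * (v * (e * (a * u))) * r2); first by rewrite !mulrA.
  rewrite ev !mulrA -(mulrA _ c) cr !mulrA vw.
  transitivity (w' * (w * (f * d)) * r4); first by rewrite !mulrA.
  by rewrite -ew !mulrA.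
Qed.

Definition loc_add (x y : left_localization) : left_localization := sval (cid (is_sum_ex x y)).
Definition loc_mul (x y : left_localization) : left_localization := sval (cid (is_prod_ex x y)).
Definition loc_zero : left_localization := frac S1 0.
Definition loc_one : left_localization := frac S1 1.

Lemma loc_addE s (Ss : S s) a b : loc_add (frac Ss a) (frac Ss b) = frac Ss (a + b).
Proof.
rewrite /loc_add; case: cid => z /= zP; apply: is_sum_uniq zP _.
by exists s, Ss, a, b.
Qed.

Lemma loc_mulE s (Ss : S s) a u (Su : S u) b t q (Sts : S (t * s)) :
  S t -> t * a = q * u ->
  loc_mul (frac Ss a) (frac Su b) = frac Sts (q * b).
Proof.
move=> St tq; rewrite /loc_mul; case: cid => z /= zP; apply: is_prod_uniq zP _.
by exists s, Ss, a, u, Su, b, t, q, Sts.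
Qed.

Lemma frac0 s (Ss : S s) : frac Ss 0 = loc_zero.
Proof. by apply/frac_eq; exists 1, s; rewrite !mulr0 mul1r mulr1. Qed.

Lemma frac_id s (Ss : S s) : frac Ss s = loc_one.
Proof. by apply/frac_eq; exists 1, s; rewrite mul1r mulr1. Qed.

Definition loc_opp (x : left_localization) : left_localization :=
  frac (denP (repr x)) (- num (repr x)).

Lemma loc_addA : associative loc_add.
Proof.
move=> x y z; have [s [Ss [a [b [c [-> -> ->]]]]]] := frac_common3 x y z.
by rewrite !loc_addE addrA.
Qed.

Lemma loc_addC : commutative loc_add.
Proof.
move=> x y; have [s [Ss [a [b [-> ->]]]]] := frac_common x y.
by rewrite !loc_addE addrC.
Qed.

Lemma loc_add0 : left_id loc_zero loc_add.
Proof.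
move=> x; have [s [Ss [a ->]]] := fracW x.
by rewrite -(frac0 Ss) loc_addE add0r.
Qed.

Lemma loc_addN : left_inverse loc_zero loc_opp loc_add.
Proof.
move=> x; rewrite /loc_opp -[X in loc_add _ X]reprK.
have -> : \pi_left_localization (repr x) = frac (denP (repr x)) (num (repr x)).
  rewrite /frac; congr (\pi _); rewrite /mk_frac /den /num.
  case: (repr x) => -[s Ss] r /=.
  by congr (exist _ _ _, _); apply: bool_irrelevance.
by rewrite loc_addE addNr frac0.
Qed.

Lemma loc_mulA : associative loc_mul.
Proof.
move=> x y z.
have [s1 [S_1 [r1 ->]]] := fracW x.
have [s2 [S_2 [r2 ->]]] := fracW y.
have [s3 [S_3 [r3 ->]]] := fracW z.
have [t [u [St tu]]] := Sore r2 S_3.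
have Sts := SM St S_2.
have [v [w [Sv vw]]] := Sore r1 Sts.
have Svs := SM Sv S_1.
have S1vs : S (1 * (v * s1)) by rewrite mul1r.
rewrite (loc_mulE _ _ _ Sts St tu) (loc_mulE _ _ _ Svs Sv vw).
have vw' : v * r1 = (w * t) * s2 by rewrite vw mulrA.
rewrite (loc_mulE _ _ _ Svs Sv vw').
have e : 1 * (w * t * r2) = (w * u) * s3 by rewrite mul1r -!mulrA tu.
rewrite (loc_mulE _ _ _ S1vs S1 e).
by apply/frac_eq; exists 1, 1; rewrite !mul1r !mulrA.
Qed.

Lemma loc_mul1l : left_id loc_one loc_mul.
Proof.
move=> x; have [s [Ss [a ->]]] := fracW x.
have S11 : S (s * 1) by rewrite mulr1.
have e : s * 1 = 1 * s by rewrite mulr1 mul1r.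
rewrite /loc_one (loc_mulE _ _ _ S11 Ss e).
by apply/frac_eq; exists 1, 1; rewrite !mul1r !mulr1.
Qed.

Lemma loc_mul1r : right_id loc_one loc_mul.
Proof.
move=> x; have [s [Ss [a ->]]] := fracW x.
have S1s : S (1 * s) by rewrite mul1r.
have e : 1 * a = a * 1 by rewrite mulr1 mul1r.
rewrite /loc_one (loc_mulE _ _ _ S1s S1 e).
by apply/frac_eq; exists 1, 1; rewrite !mul1r !mulr1.
Qed.

Lemma loc_mulDl : left_distributive loc_mul loc_add.
Proof.
move=> x y z; have [s [Ss [a [b [-> ->]]]]] := frac_common x y.
have [u [Su [r ->]]] := fracW z.
have [t [q [St tq]]] := Sore a Su.
have [t' [q' [St' tq']]] := Sore (t * b) Su.
have St't := SM St' St.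
have Sts := SM St't Ss.
have ea : t' * t * a = (t' * q) * u by rewrite -!mulrA tq.
have eb : t' * t * b = q' * u by rewrite -mulrA tq'.
have eab : t' * t * (a + b) = (t' * q + q') * u by rewrite mulrDr ea eb mulrDl.
rewrite loc_addE (loc_mulE _ _ _ Sts St't ea) (loc_mulE _ _ _ Sts St't eb).
by rewrite (loc_mulE _ _ _ Sts St't eab) loc_addE mulrDl.
Qed.

Lemma loc_mulDr : right_distributive loc_mul loc_add.
Proof.
move=> x y z; have [s [Ss [a [b [-> ->]]]]] := frac_common y z.
have [u [Su [r ->]]] := fracW x.
have [t [q [St tq]]] := Sore r Ss.
have Stu := SM St Su.
by rewrite loc_addE !(loc_mulE _ _ _ Stu St tq) loc_addE mulrDr.
Qed.

Lemma loc_one_neq0 : loc_one != loc_zero.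
Proof.
apply/eqP => /frac_eq [c [d [Sc]]]; rewrite !mulr1 mulr0 => _ c0.
by apply: S0; rewrite -c0 -[c]mulr1.
Qed.

HB.instance Definition _ := GRing.isZmodule.Build left_localization
  loc_addA loc_addC loc_add0 loc_addN.
HB.instance Definition _ := GRing.Zmodule_isNzRing.Build left_localization
  loc_mulA loc_mul1l loc_mul1r loc_mulDl loc_mulDr loc_one_neq0.

Definition loc_map (r : R) : left_localization := frac S1 r.

Lemma loc_map_is_zmod_morphism : zmod_morphism loc_map.
Proof.
move=> x y; apply/eqP; rewrite eq_sym subr_eq; apply/eqP.
by rewrite /loc_map -[in LHS](subrK y x); symmetry; apply: loc_addE.
Qed.

Lemma loc_map_is_monoid_morphism : monoid_morphism loc_map.
Proof.
split=> // x y.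
have S11 : S (1 * 1) by rewrite mul1r.
have e : 1 * x = x * 1 by rewrite mul1r mulr1.
rewrite /loc_map; apply: esym; apply: etrans (loc_mulE _ _ _ S11 S1 e) _.
by apply/frac_eq; exists 1, 1; rewrite !mul1r.
Qed.

HB.instance Definition _ := GRing.isZmodMorphism.Build R left_localization
  loc_map loc_map_is_zmod_morphism.
HB.instance Definition _ := GRing.isMonoidMorphism.Build R left_localization
  loc_map loc_map_is_monoid_morphism.

Lemma loc_map_mul_frac s (Ss : S s) r : loc_map s * frac Ss r = loc_map r.
Proof.
have S11 : S (1 * 1) by rewrite mul1r.
have e : 1 * s = 1 * s by [].
apply: etrans (loc_mulE _ _ _ S11 S1 e) _.
by apply/frac_eq; exists 1, 1; rewrite !mul1r.
Qed.

Lemma frac_mul_loc_map s (Ss : S s) : frac Ss 1 * loc_map s = 1.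
Proof.
have S1s : S (1 * s) by rewrite mul1r.
have e : 1 * 1 = 1 * 1 :> R by [].
apply: etrans (loc_mulE _ _ _ S1s S1 e) _.
by apply: etrans (frac_id S1s) => //; rewrite mul1r.
Qed.

Lemma loc_map_invertible s : S s -> invertible (loc_map s).
Proof.
move=> Ss; exists (frac Ss 1).
by rewrite frac_mul_loc_map loc_map_mul_frac; split=> //; rewrite rmorph1.
Qed.

Lemma loc_map_eq0 r : loc_map r = 0 <-> ass S r.
Proof.
split=> [/frac_eq [c [d []]]|[s Ss sr]].
  by rewrite !mulr1 mulr0 => Sc _ cr; exists c.
apply/frac_eq; exists s, s; by rewrite mulr1 mulr0.
Qed.

Lemma fracE s (Ss : S s) r y :
  y * loc_map s = 1 -> frac Ss r = y * loc_map r.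
Proof. by move=> ys; rewrite -(loc_map_mul_frac Ss) mulrA ys mul1r. Qed.

End LeftLocalization.

(* The product ring of a (dependent) family, with componentwise operations.  It
   is only a [pzRingType] because the index type may be empty. *)
Section ProductRing.
Variables (I : Type) (F : I -> nzRingType).

Definition prod_ring : Type := forall i, F i.
HB.instance Definition _ := gen_eqMixin prod_ring.
HB.instance Definition _ := gen_choiceMixin prod_ring.

Definition prod_ring_zero : prod_ring := fun i => 0.
Definition prod_ring_one : prod_ring := fun i => 1.
Definition prod_ring_opp (f : prod_ring) : prod_ring := fun i => - f i.
Definition prod_ring_add (f g : prod_ring) : prod_ring := fun i => f i + g i.
Definition prod_ring_mul (f g : prod_ring) : prod_ring := fun i => f i * g i.

Fact prod_ring_addA : associative prod_ring_add.
Proof. by move=> f g h; apply/functional_extensionality_dep => i; apply: addrA. Qed.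
Fact prod_ring_addC : commutative prod_ring_add.
Proof. by move=> f g; apply/functional_extensionality_dep => i; apply: addrC. Qed.
Fact prod_ring_add0 : left_id prod_ring_zero prod_ring_add.
Proof. by move=> f; apply/functional_extensionality_dep => i; apply: add0r. Qed.
Fact prod_ring_addN : left_inverse prod_ring_zero prod_ring_opp prod_ring_add.
Proof. by move=> f; apply/functional_extensionality_dep => i; apply: addNr. Qed.
Fact prod_ring_mulA : associative prod_ring_mul.
Proof. by move=> f g h; apply/functional_extensionality_dep => i; apply: mulrA. Qed.
Fact prod_ring_mul1l : left_id prod_ring_one prod_ring_mul.
Proof. by move=> f; apply/functional_extensionality_dep => i; apply: mul1r. Qed.
Fact prod_ring_mul1r : right_id prod_ring_one prod_ring_mul.
Proof. by move=> f; apply/functional_extensionality_dep => i; apply: mulr1. Qed.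
Fact prod_ring_mulDl : left_distributive prod_ring_mul prod_ring_add.
Proof. by move=> f g h; apply/functional_extensionality_dep => i; apply: mulrDl. Qed.
Fact prod_ring_mulDr : right_distributive prod_ring_mul prod_ring_add.
Proof. by move=> f g h; apply/functional_extensionality_dep => i; apply: mulrDr. Qed.

HB.instance Definition _ := GRing.isZmodule.Build prod_ring
  prod_ring_addA prod_ring_addC prod_ring_add0 prod_ring_addN.
HB.instance Definition _ := GRing.Zmodule_isPzRing.Build prod_ring
  prod_ring_mulA prod_ring_mul1l prod_ring_mul1r prod_ring_mulDl prod_ring_mulDr.

End ProductRing.

Definition ring_isomorphic (A B : pzRingType) : Prop :=
  exists f : {rmorphism A -> B}, bijective f.

Definition product_of_local_rings (Q : nzRingType) : Prop :=
  exists (n : nat) (F : 'I_n -> nzRingType),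
    [/\ (1 <= n)%N,
        ring_isomorphic Q (prod_ring F),
        forall i, local_ring (F i) &
        forall i, jacobson_radical (F i) = nil_radical (F i)].

Definition classical_left_quotient_ring (R : nzRingType)
    (oreC : left_Ore (regular_elements R)) : nzRingType :=
  left_localization (regular_left_Ore_denominator (fun _ h => h) oreC).

Definition largest_left_quotient_ring (R : nzRingType) : nzRingType :=
  left_localization (largest_regular_den_denominator R).

(* Main.v *)
(* A ring map f : R -> P is treated as a localization of R when every p in P has
   the form f(u)^-1 f(r) and ker f consists of the elements killed on the left by
   some u with f(u) invertible.  Such maps compose, and the preimage of the
   units of P is then a left denominator set.  Hence if S is maximal, a left
   denominator set of S^-1 R consists of units, since otherwise composing the
   two localizations would enlarge S; so if S^-1 R is weakly left localizable,
   its elements are units or nilpotent, which characterizes the local rings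
   whose radical is the nil radical.
   Condition (d) gives, for each j, an element x_j of R that is a unit in
   S_j^-1 R and zero in the other factors.  Sums of multiples of the x_j provide
   common denominators, so R embeds in the product of the S_i^-1 R as a
   localization, at the set of all regular elements.
   Conversely, if Q_l(R) is such a product, the preimages in R of the units of
   the factors are exactly the maximal left denominator sets: a denominator set
   contained in none of them would contain, for each i, an element with
   vanishing i-th component, hence 0. *)
From HB Require Import structures.
Require Import Defs.
From mathcomp Require Import all_boot all_algebra.
From mathcomp Require Import boolp classical_sets cardinality.
Local Open Scope classical_set_scope.
Local Open Scope ring_scope.
Import GRing.Theory.

Set Implicit Arguments.
Unset Strict Implicit.
Unset Printing Implicit Defensive.

(** * Units in possibly trivial rings *)

Section TwoSidedInverses.
Variable P : pzRingType.
Implicit Types x y z : P.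

(* [invertible] for rings that may be trivial, such as [prod_ring]; the two
   are convertible on an [nzRingType]. *)
Definition is_unit x := exists y, x * y = 1 /\ y * x = 1.

Lemma is_unit1 : is_unit (1 : P).
Proof. by exists 1; rewrite mulr1. Qed.

Lemma is_unitM x y : is_unit x -> is_unit y -> is_unit (x * y).
Proof.
move=> [x' [xx' x'x]] [y' [yy' y'y]]; exists (y' * x'); split.
  by rewrite mulrA -(mulrA x) yy' mulr1.
by rewrite mulrA -(mulrA y') x'x mulr1.
Qed.

Lemma is_unitX x n : is_unit x -> is_unit (x ^+ n).
Proof.
move=> ux; elim: n => [|n IHn]; first by rewrite expr0; apply: is_unit1.
by rewrite exprS; apply: is_unitM.
Qed.

Lemma is_unit_mulI x : is_unit x -> injective ( *%R x).
Proof. by move=> [v [_ vx]] y z e; rewrite -[y]mul1r -[z]mul1r -vx -!mulrA e. Qed.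

Lemma is_unit_factorr x y : is_unit x -> is_unit (x * y) -> is_unit y.
Proof.
move=> ux [z [xyz zxy]]; exists (z * x); split; last by rewrite -mulrA.
apply: (is_unit_mulI ux); by rewrite !mulrA xyz mul1r mulr1.
Qed.

Lemma is_unit_neq0 x : (1 : P) != 0 -> is_unit x -> x != 0.
Proof.
by move=> nz1 [y [xy _]]; apply: contraNneq nz1 => x0; rewrite -xy x0 mul0r.
Qed.

End TwoSidedInverses.

Lemma rmorph_is_unit (A B : pzRingType) (f : {rmorphism A -> B}) x :
  is_unit x -> is_unit (f x).
Proof. by move=> [y [xy yx]]; exists (f y); rewrite -!rmorphM xy yx rmorph1. Qed.

(** * Localization maps, their lifts and composites *)

Section LeftLocalizationMaps.
Variable R : nzRingType.

Definition unit_preimage (P : pzRingType) (f : R -> P) : set R :=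
  [set r | is_unit (f r)].

(* [f] has the universal property of the left localization of [R] at
   [unit_preimage f]. *)
Definition left_localization_map (P : pzRingType) (f : R -> P) :=
  (forall p, exists u r, is_unit (f u) /\ f u * p = f r) /\
  (forall r, f r = 0 -> exists2 u, is_unit (f u) & u * r = 0).

Section UnitPreimage.
Variables (P : pzRingType) (f : {rmorphism R -> P}).
Hypotheses (nz1 : (1 : P) != 0) (locf : left_localization_map f).

Lemma unit_preimage_denominator : left_denominator (unit_preimage f).
Proof.
have [fracP kerP] := locf; split; first split.
- by rewrite /unit_preimage /= rmorph1; apply: is_unit1.
- by move=> /(is_unit_neq0 nz1); rewrite rmorph0 eqxx.
- by move=> s t us ut; rewrite /unit_preimage /= rmorphM; apply: is_unitM.
(* Write f(r) f(s)^-1 as a left fraction f(u)^-1 f(q); then [u * r - q * s] lies in the kernel, so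
   some [v] kills it. *)
- move=> r s [y [sy ys]]; have [u [q [uu e]]] := fracP (f r * y).
  have [|v uv e0] := kerP (u * r - q * s).
    by rewrite rmorphB !rmorphM -e -!mulrA ys mulr1 subrr.
  exists (v * u), (v * q); split.
    by rewrite /unit_preimage /= rmorphM; apply: is_unitM.
  by apply/subr0_eq; rewrite -!mulrA -mulrBr.
- move=> r s [y [sy _]] rs0; have [|u uu ur] := kerP r; last by exists u.
  by rewrite -[f r]mulr1 -sy mulrA -rmorphM rs0 rmorph0 mul0r.
Qed.

Lemma ass_unit_preimage r : ass (unit_preimage f) r <-> f r = 0.
Proof.
split=> [[s us sr]|/locf.2[u uu ur]]; last by exists u.
by apply: (is_unit_mulI us); rewrite mulr0 -rmorphM sr rmorph0.
Qed.

End UnitPreimage.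

Section Lift.
Variables (S : set R) (denS : left_denominator S).

Lemma loc_map_left_localization_map : left_localization_map (loc_map denS).
Proof.
split=> [p|r /loc_map_eq0[s Ss sr]]; last first.
  by exists s => //; apply: loc_map_invertible.
have [s [Ss [r ->]]] := fracW p; exists s, r; rewrite loc_map_mul_frac.
by split=> //; apply: loc_map_invertible.
Qed.

Variables (P : pzRingType) (f : {rmorphism R -> P}).
Hypothesis unitf : S `<=` unit_preimage f.

(** A relation at first, because [x] has many fractions s^-1 r; [lift_relP] shows that the choice
    does not matter. *)
Definition lift_rel (x : left_localization denS) (p : P) :=
  exists s r, [/\ S s, loc_map denS s * x = loc_map denS r & f s * p = f r].

(** Over the common denominator [t * s = q * s'], the numerators differ by an element of [ass S]; it
    is killed by some [v] in [S], and [f v] can be cancelled. *)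
Lemma lift_relP x p s r : S s -> lift_rel x p ->
  loc_map denS s * x = loc_map denS r -> f s * p = f r.
Proof.
move=> Ss [s' [r' [Ss' ex ep]]] e; have [[_ _ SM oreS] _] := denS.
have [t [q [St tq]]] := oreS s s' Ss'.
have : loc_map denS (t * r - q * r') = 0.
  by rewrite rmorphB !rmorphM /= -e -ex !mulrA -!rmorphM tq subrr.
move=> /loc_map_eq0[v Sv ev].
apply: (@is_unit_mulI _ (f (v * t))); first by apply/unitf/SM.
have {}ev : v * t * r = v * q * r'.
  by apply/subr0_eq; rewrite -!mulrA -mulrBr.
by rewrite mulrA -!rmorphM ev -mulrA tq mulrA !rmorphM -ep !mulrA.
Qed.

Lemma lift_rel_ex x : exists p, lift_rel x p.
Proof.
have [s [Ss [r ->]]] := fracW x; have [y [sy _]] := unitf Ss.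
by exists (y * f r), s, r; rewrite loc_map_mul_frac mulrA sy mul1r.
Qed.

Definition loc_lift x : P := sval (cid (lift_rel_ex x)).

Lemma loc_liftP x : lift_rel x (loc_lift x).
Proof. exact: svalP. Qed.

Lemma loc_lift_eq x p s r : S s ->
  loc_map denS s * x = loc_map denS r -> f s * p = f r -> loc_lift x = p.
Proof.
move=> Ss ex ep; apply: (@is_unit_mulI _ (f s)); first exact: unitf.
by rewrite ep; apply: lift_relP ex => //; apply: loc_liftP.
Qed.

Lemma loc_lift_is_zmod_morphism : zmod_morphism loc_lift.
Proof.
move=> x y; have [s [Ss [a [b [ex ey]]]]] := frac_common x y.
have {}ex : loc_map denS s * x = loc_map denS a by rewrite ex loc_map_mul_frac.
have {}ey : loc_map denS s * y = loc_map denS b by rewrite ey loc_map_mul_frac.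
apply: (@loc_lift_eq _ _ s (a - b)) => //; first by rewrite mulrBr ex ey rmorphB.
by rewrite mulrBr rmorphB; congr (_ - _); apply: lift_relP Ss (loc_liftP _) _.
Qed.

Lemma loc_lift_is_monoid_morphism : monoid_morphism loc_lift.
Proof.
have [[S1 _ SM oreS] _] := denS; split.
  by apply: (@loc_lift_eq _ _ 1 1) => //; rewrite mulr1.
move=> x y; have [s [a [Ss ex ex']]] := loc_liftP x.
have [u [b [Su ey ey']]] := loc_liftP y.
have [t [q [St tq]]] := oreS a u Su.
apply: (@loc_lift_eq _ _ (t * s) (q * b)); first exact: SM.
  rewrite !rmorphM /= -ey -mulrA (mulrA (loc_map denS s)) ex !mulrA.
  by rewrite -!rmorphM tq.
rewrite !rmorphM -ey' -mulrA (mulrA (f s)) ex' !mulrA.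
by rewrite -!rmorphM tq.
Qed.

HB.instance Definition _ := GRing.isZmodMorphism.Build
  (left_localization denS) P loc_lift loc_lift_is_zmod_morphism.
HB.instance Definition _ := GRing.isMonoidMorphism.Build
  (left_localization denS) P loc_lift loc_lift_is_monoid_morphism.

End Lift.
End LeftLocalizationMaps.

Lemma bijective_left_localization_map (R : nzRingType) (P : pzRingType)
    (f : {rmorphism R -> P}) :
  bijective f -> left_localization_map f.
Proof.
move=> bijf; have [g fK gK] := bijf; split=> [p|r fr0].
  by exists 1, (g p); rewrite gK rmorph1 mul1r; split=> //; apply: is_unit1.
exists 1; first by rewrite rmorph1; apply: is_unit1.
by rewrite mul1r; apply: (bij_inj bijf); rewrite rmorph0.
Qed.

Lemma comp_left_localization_map (R Q : nzRingType) (P : pzRingType)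
    (f : {rmorphism R -> Q}) (g : {rmorphism Q -> P}) :
  left_localization_map f -> left_localization_map g ->
  left_localization_map (g \o f).
Proof.
move=> [fracf kerf] [fracg kerg]; split=> [p|r /= /kerg[v uv vr]].
  (* Here p = g(v)^-1 g(q). Writing [v], then [f u1 * q], as fractions over [R] gives [p] the
     denominator [u2 * a] and the numerator [b]. *)
  have [v [q [uv vp]]] := fracg p.
  have [u1 [a [uu1 u1v]]] := fracf v.
  have [u2 [b [uu2 u2q]]] := fracf (f u1 * q).
  have e : f (u2 * a) = f (u2 * u1) * v by rewrite !rmorphM -u1v mulrA.
  exists (u2 * a), b => /=; rewrite e rmorphM; split.
    by apply: is_unitM uv; rewrite !rmorphM; apply: is_unitM; apply: rmorph_is_unit.
  by rewrite -mulrA vp -rmorphM (rmorphM f) -mulrA u2q.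
(* The numerator [a] of [v] annihilates [f r] as well, and [w] turns this into a relation in [R]. *)
have [u [a [uu uva]]] := fracf v.
have [|w uw war] := kerf (a * r).
  by rewrite rmorphM -uva -mulrA vr mulr0.
exists (w * a); last by rewrite -mulrA.
rewrite /= rmorphM -uva !rmorphM.
by do 2?apply: is_unitM => //; apply: rmorph_is_unit.
Qed.

Lemma left_localization_isomorphic (R : nzRingType) (P : pzRingType)
    (f : {rmorphism R -> P}) (S : set R) (denS : left_denominator S) :
  left_localization_map f -> unit_preimage f = S ->
  ring_isomorphic (left_localization denS) P.
Proof.
move=> locf eS; have unitf : S `<=` unit_preimage f by rewrite eS.
pose phi : {rmorphism left_localization denS -> P} := loc_lift unitf.
have phi_inj : injective phi.
  apply: raddf_inj => x phix0; have [s [r [Ss ex]]] := loc_liftP unitf x.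
  rewrite -/(phi x) phix0 mulr0 => /esym /(ass_unit_preimage locf).
  rewrite eS => /(loc_map_eq0 denS) r0.
  by apply: (is_unit_mulI (loc_map_invertible denS Ss)); rewrite mulr0 ex.
have phi_surj p : exists x, phi x = p.
  have [s [r [us e]]] := locf.1 p; have Ss : S s by rewrite -eS.
  exists (Defs.frac denS Ss r).
  by apply: (@loc_lift_eq _ _ _ _ _ unitf _ _ s r) => //; apply: loc_map_mul_frac.
exists phi, (fun p => sval (cid (phi_surj p))) => [x|p]; last by case: cid.
by apply: phi_inj; case: cid.
Qed.

(** * Local rings whose radical is the nil radical *)

Section UnitOrNilpotent.
Implicit Types Q : nzRingType.

(** Elementwise form of the condition on the local factors; see [unit_or_nilpotentP]. *)
Definition unit_or_nilpotent Q := forall x : Q, invertible x \/ nilpotent x.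

Lemma nilpotent_no_right_inverse Q (x y : Q) : nilpotent x -> x * y <> 1.
Proof.
move=> [n xn0] xy1; have : x ^+ n * y ^+ n = 1.
  elim: n {xn0} => [|n IHn]; first by rewrite mulr1.
  by rewrite exprSr exprS -mulrA (mulrA x) xy1 mul1r.
by rewrite xn0 mul0r => /eqP; rewrite eq_sym oner_eq0.
Qed.

Lemma nilpotent_no_left_inverse Q (x y : Q) : nilpotent x -> y * x <> 1.
Proof.
move=> [n xn0] yx1; have : y ^+ n * x ^+ n = 1.
  elim: n {xn0} => [|n IHn]; first by rewrite mulr1.
  by rewrite exprSr exprS -mulrA (mulrA y) yx1 mul1r.
by rewrite xn0 mulr0 => /eqP; rewrite eq_sym oner_eq0.
Qed.

Lemma nilpotent_not_invertible Q (x : Q) : nilpotent x -> ~ invertible x.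
Proof. by move=> /nilpotent_no_right_inverse nx [y [/nx]]. Qed.

(** If x^n = 0, then (x + y)^n agrees with x^n modulo J, so it lies in J and is nilpotent. *)
Lemma nil_idealD Q (I J : set Q) : nil_ideal I -> nil_ideal J ->
  nil_ideal [set z | exists x y, [/\ I x, J y & z = x + y]].
Proof.
move=> [[[I0 IB IMl] IMr] nilI] [[[J0 JB JMl] JMr] nilJ].
split; first split; first split.
- by exists 0, 0; rewrite addr0.
- move=> _ _ [x [y [Ix Jy ->]]] [x' [y' [Ix' Jy' ->]]].
  by exists (x - x'), (y - y'); rewrite opprD addrACA; split; auto.
- by move=> r _ [x [y [Ix Jy ->]]]; exists (r * x), (r * y); rewrite mulrDr; split; auto.
- by move=> _ r [x [y [Ix Jy ->]]]; exists (x * r), (y * r); rewrite mulrDl; split; auto.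
move=> _ [x [y [Ix Jy ->]]]; have [n xn0] := nilI x Ix.
have JN z : J z -> J (- z) by rewrite -sub0r => Jz; apply: JB.
have JD z t : J z -> J t -> J (z + t).
  by move=> Jz /JN Jt; rewrite -[t]opprK; apply: JB.
have /nilJ[m] : J ((x + y) ^+ n).
  rewrite -[X in J X]subr0 -xn0; elim: n {xn0} => [|n IHn].
    by rewrite subrr.
  rewrite exprS [x ^+ n.+1]exprS.
  have -> : (x + y) * (x + y) ^+ n - x * x ^+ n =
            x * ((x + y) ^+ n - x ^+ n) + y * (x + y) ^+ n.
    by rewrite mulrBr mulrDl addrAC.
  by apply: JD; [apply: JMl | apply: JMr].
by rewrite -exprM => ?; exists (n * m)%N.
Qed.

(** Only finitely many nil ideals occur in the sum, and by [nil_idealD] one nil ideal contains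
    it. *)
Lemma nil_radical_nilpotent Q (x : Q) : nil_radical Q x -> nilpotent x.
Proof.
move=> [n [a [nila ->]]].
suff [I [_ nilI] /nilI] : exists2 I, nil_ideal I & I (\sum_(i < n) a i) by [].
elim/big_ind: _ => [|y z [I nilI Iy] [J nilJ Jz]|i _]; last exact: nila.
  exists [set 0] => //; split=> [|y ->]; last by exists 1%N; rewrite expr1.
  split; first split=> //.
  - by move=> y z /= -> ->; rewrite subr0.
  - by move=> r y /= ->; rewrite mulr0.
  - by move=> y r /= ->; rewrite mul0r.
exists [set t | exists u v, [/\ I u, J v & t = u + v]]; first exact: nil_idealD.
by exists y, z.
Qed.

Section Nonunits.
Variable Q : nzRingType.

Lemma unit_or_nilpotent_local : unit_or_nilpotent Q -> local_ring Q.
Proof.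
move=> unitQ; have nilN (x : Q) : ~ invertible x -> nilpotent x.
  by case: (unitQ x).
have NMl (r x : Q) : ~ invertible x -> ~ invertible (r * x).
  move=> /nilN nx [y [_ yrx]].
  by apply: (nilpotent_no_left_inverse (y := y * r) nx); rewrite -mulrA.
split; first split=> //.
- by apply: nilpotent_not_invertible; exists 1%N; rewrite expr1.
(* From v (x - y) = 1 we get v x = 1 + v y with v y nilpotent; the geometric series inverts v x,
   which is nilpotent too. *)
- move=> x y Nx Ny [v [_ vxy]].
  have [n vyn0] := nilN _ (NMl v y Ny).
  have := subrX1 (- (v * y)) n; rewrite [_ ^+ n]exprNn vyn0 mulr0 sub0r.
  have -> : - (v * y) - 1 = - (v * x).
    by rewrite -vxy mulrBr opprB addKr.
  rewrite mulNr => /oppr_inj/esym; apply: nilpotent_no_right_inverse.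
  exact/nilN/NMl.
- move=> x r /nilN nx [y [xry _]].
  by apply: (nilpotent_no_right_inverse (y := r * y) nx); rewrite mulrA.
Qed.

Lemma proper_left_ideal_nonunits (I : set Q) :
  left_ideal I -> I != setT -> I `<=` [set x | ~ invertible x].
Proof.
move=> [_ _ IM] /eqP nIT x Ix [y [_ yx1]]; apply: nIT; apply/seteqP; split=> // z _.
by rewrite -[z]mulr1 -yx1 mulrA; apply: IM.
Qed.

(** The nonunits contain every proper left ideal, so they form the only maximal left ideal. *)
Lemma local_jacobson : local_ring Q ->
  jacobson_radical Q = [set x | ~ invertible x].
Proof.
move=> [locQ _]; have nT : [set x : Q | ~ invertible x] != setT.
  apply/eqP => e; have : [set x : Q | ~ invertible x] 1 by rewrite e.
  by apply; apply: is_unit1.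
apply/seteqP; split=> [x|x Nx I [idI IT maxI]].
  apply; split=> // J idJ NJ /(proper_left_ideal_nonunits idJ) JN.
  exact/seteqP.
by rewrite -(maxI _ locQ) //; apply: proper_left_ideal_nonunits.
Qed.

Lemma unit_or_nilpotentP :
  unit_or_nilpotent Q <-> local_ring Q /\ jacobson_radical Q = nil_radical Q.
Proof.
split=> [unitQ|[locQ eJ] x]; last first.
  have [|nux] := pselect (invertible x); [by left | right].
  by apply: nil_radical_nilpotent; rewrite -eJ local_jacobson.
have locQ := unit_or_nilpotent_local unitQ; split=> //.
rewrite local_jacobson //; apply/seteqP; split=> x; last first.
  by move=> /nil_radical_nilpotent/nilpotent_not_invertible.
move=> Nx; exists 1%N, (fun=> x); rewrite big_ord1; split=> // _.
by exists [set y | ~ invertible y] => //; split=> // y; case: (unitQ y).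
Qed.

(** The units form a left denominator set, being the unit preimage of the identity map. *)
Lemma unit_or_nilpotent_weakly_localizable :
  unit_or_nilpotent Q -> weakly_left_localizable Q.
Proof.
move=> unitQ x nx; exists (unit_preimage (@idfun Q)); last first.
  by case: (unitQ x).
apply: unit_preimage_denominator; first exact: oner_neq0.
by apply: bijective_left_localization_map; exists id.
Qed.

Lemma unit_or_nilpotent_isomorphic (P : nzRingType) :
  ring_isomorphic Q P -> unit_or_nilpotent P -> unit_or_nilpotent Q.
Proof.
move=> [f bijf] unitP x; have finj := bij_inj bijf.
have [[y [xy yx]]|[n xn0]] := unitP (f x).
  left; have [g _ gK] := bijf; exists (g y).
  by split; apply: finj; rewrite rmorphM rmorph1 gK.
by right; exists n; apply: finj; rewrite rmorphXn xn0 rmorph0.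
Qed.

End Nonunits.
End UnitOrNilpotent.

(** * Localization at a maximal left denominator set *)

Section MaximalDenominators.
Variables (R : nzRingType) (S : set R).
Hypothesis maxS : max_Den R S.

Lemma max_Den_unit_preimage (P : pzRingType) (f : {rmorphism R -> P}) :
  (1 : P) != 0 -> left_localization_map f -> S `<=` unit_preimage f ->
  unit_preimage f = S.
Proof. by move=> nz1 locf Sf; apply: maxS.2 Sf; apply: unit_preimage_denominator. Qed.

Variable denS : left_denominator S.

(* By maximality, inverting [T] in the localization inverts no further element
   of [R]. *)
Lemma max_Den_localizable_unit (T : set (left_localization denS)) :
  left_denominator T -> T `<=` [set x | invertible x].
Proof.
move=> denT q Tq; pose h := loc_map denT \o loc_map denS.
have hS : unit_preimage h = S.
  apply: max_Den_unit_preimage; first exact: oner_neq0.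
    apply: comp_left_localization_map; exact: loc_map_left_localization_map.
  move=> s Ss; apply: (@rmorph_is_unit _ _ (loc_map denT) (loc_map denS s)).
  exact: loc_map_invertible.
(* The numerator [r] of [q] becomes a unit under [h], hence lies in [S]. *)
have [u [r [uu e]]] := (loc_map_left_localization_map denS).1 q.
apply: (is_unit_factorr uu); rewrite e; apply: loc_map_invertible.
rewrite -hS /unit_preimage /h /= -e rmorphM; apply: is_unitM.
  exact: rmorph_is_unit.
exact: loc_map_invertible.
Qed.

Lemma max_Den_unit_or_nilpotent :
  weakly_left_localizable (left_localization denS) ->
  unit_or_nilpotent (left_localization denS).
Proof.
move=> wll x; have [|/wll[T denT Tx]] := pselect (nilpotent x); first by right.
by left; apply: max_Den_localizable_unit denT _ Tx.
Qed.

End MaximalDenominators.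

(** * Localization maps into finite products *)

Section ProductMaps.
Variables (n : nat) (F : 'I_n -> nzRingType).

Definition prod_proj i (p : prod_ring F) : F i := p i.

Lemma prod_proj_is_zmod_morphism i : zmod_morphism (prod_proj i).
Proof. by []. Qed.
Lemma prod_proj_is_monoid_morphism i : monoid_morphism (prod_proj i).
Proof. by []. Qed.
HB.instance Definition _ i := GRing.isZmodMorphism.Build (prod_ring F) (F i)
  (prod_proj i) (prod_proj_is_zmod_morphism i).
HB.instance Definition _ i := GRing.isMonoidMorphism.Build (prod_ring F) (F i)
  (prod_proj i) (prod_proj_is_monoid_morphism i).

Lemma prod_is_unit (p : prod_ring F) :
  is_unit p <-> forall i, is_unit (p i).
Proof.
split=> [up i|up]; first exact: (@rmorph_is_unit _ _ (prod_proj i)).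
exists (fun i => sval (cid (up i))).
by split; apply/functional_extensionality_dep => i; have [] := svalP (cid (up i)).
Qed.

Lemma prod_eq0 (p : prod_ring F) : p = 0 <-> forall i, p i = 0.
Proof. by split=> [-> i //|p0]; apply/functional_extensionality_dep => i; apply: p0. Qed.

Lemma prod_ring_nontrivial (i : 'I_n) : (1 : prod_ring F) != 0.
Proof. by apply/eqP => /prod_eq0/(_ i)/eqP; rewrite oner_eq0. Qed.

Variable R : nzRingType.

Section Tupling.
Variable f : forall i, {rmorphism R -> F i}.

Definition prod_map (r : R) : prod_ring F := fun i => f i r.

Lemma prod_map_is_zmod_morphism : zmod_morphism prod_map.
Proof. by move=> x y; apply/functional_extensionality_dep => i; apply: rmorphB. Qed.
Lemma prod_map_is_monoid_morphism : monoid_morphism prod_map.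
Proof.
split=> [|x y]; apply/functional_extensionality_dep => i.
  exact: rmorph1.
exact: rmorphM.
Qed.
HB.instance Definition _ := GRing.isZmodMorphism.Build R (prod_ring F)
  prod_map prod_map_is_zmod_morphism.
HB.instance Definition _ := GRing.isMonoidMorphism.Build R (prod_ring F)
  prod_map prod_map_is_monoid_morphism.

Hypothesis locf : forall i, left_localization_map (f i).
Hypothesis sepf : forall i j, i != j -> exists2 x, f i x = 0 & is_unit (f j x).

(** Multiply the pairwise separators for [j] over all other indices. *)
Lemma separating_element j :
  exists2 x, is_unit (f j x) & forall i, i != j -> f i x = 0.
Proof.
suff H (l : seq 'I_n) :
    exists2 x, is_unit (f j x) & forall i, i \in l -> i != j -> f i x = 0.
  by have [x ux x0] := H (enum 'I_n); exists x => // i; apply: x0; rewrite mem_enum.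
elim: l => [|k l [x ux x0]].
  by exists 1; rewrite // rmorph1; apply: is_unit1.
have [->|kj] := eqVneq k j.
  by exists x => // i; rewrite inE => /orP[/eqP->|/x0//]; rewrite eqxx.
have [y y0 uy] := sepf kj; exists (y * x).
  by rewrite rmorphM; apply: is_unitM.
move=> i; rewrite inE rmorphM => /orP[/eqP->|il ij]; first by rewrite y0 mul0r.
by rewrite (x0 i) ?mulr0.
Qed.

Lemma prod_left_localization_map :
  (forall r, prod_map r = 0 -> r = 0) -> left_localization_map prod_map.
Proof.
move=> injf; split=> [p|r /injf ->]; last first.
  by exists 1; rewrite ?mulr0 // rmorph1; apply: is_unit1.
pose x j := s2val (cid2 (separating_element j)).
have ux j : is_unit (f j (x j)) by rewrite /x; case: cid2.
have x0 i j : i != j -> f i (x j) = 0 by rewrite /x; case: cid2 => /= y _; apply.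
(* In component [i] only the [i]-th summand survives, so denominators chosen separately in each
   factor combine into one. *)
have sx (y : 'I_n -> R) i : f i (\sum_j x j * y j) = f i (x i) * f i (y i).
  rewrite rmorph_sum (bigD1 i) //= rmorphM big1 ?addr0 // => j ji.
  by rewrite rmorphM x0 ?mul0r // eq_sym.
pose u i := sval (cid ((locf i).1 (p i))).
have /choice[r ur] i : exists r, is_unit (f i (u i)) /\ f i (u i) * p i = f i r.
  by rewrite /u; case: cid.
exists (\sum_j x j * u j), (\sum_j x j * r j); split.
  by apply/prod_is_unit => i; rewrite /prod_map sx; apply: is_unitM => //; case: (ur i).
apply/functional_extensionality_dep => i.
apply: (etrans (y := f i (\sum_j x j * u j) * p i)); first by [].
by rewrite /prod_map !sx -mulrA (ur i).2.
Qed.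

End Tupling.

Section Components.
Variable h : {rmorphism R -> prod_ring F}.
Hypotheses (loch : left_localization_map h) (injh : forall r, h r = 0 -> r = 0).

Lemma component_separating i :
  exists2 b, is_unit (h b i) & forall j, j != i -> h b j = 0.
Proof.
(* The numerator of the [i]-th central idempotent has the required components. *)
pose e : prod_ring F := fun j => (j == i)%:R.
have [a [b [/prod_is_unit ua hb]]] := loch.1 e.
have hbE j : h b j = h a j * (j == i)%:R by rewrite -hb.
exists b => [|j /negPf ji]; rewrite hbE ?ji ?mulr0 //.
by rewrite eqxx mulr1.
Qed.

Lemma component_left_localization_map i :
  left_localization_map (prod_proj i \o h).
Proof.
split=> [p|r hr0].
  have [u [r [/prod_is_unit uu e]]] := loch.1 (dfwith (fun j => 0 : F j) p).
  exists u, r; split; first exact: uu.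
  by rewrite /= /prod_proj -e; congr (_ * _); rewrite dfwith_in.
(* [b] vanishes outside component [i] and [r] vanishes in it, so [b * r] is 0 by injectivity. *)
have [b ub b0] := component_separating i; exists b => //.
apply: injh; rewrite rmorphM; apply/prod_eq0 => j.
apply: (etrans (y := h b j * h r j)); first by [].
by have [->|/b0->] := eqVneq j i; rewrite ?mul0r // (_ : h r i = 0) ?mulr0.
Qed.

Hypothesis unitF : forall i, unit_or_nilpotent (F i).

Let D i := unit_preimage (prod_proj i \o h).

Lemma component_denominator i : left_denominator (D i).
Proof.
apply: unit_preimage_denominator; first exact: oner_neq0.
exact: component_left_localization_map.
Qed.

(* Otherwise [T] contains, for each [i], an element with vanishing [i]-th
   component, hence it contains their product, which is 0. *)
Lemma denominator_sub_component (T : set R) :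
  left_denominator T -> exists i, T `<=` D i.
Proof.
move=> [[T1 T0 TM _] _]; apply: contrapT => noD.
have vanish i : exists2 s, T s & h s i = 0.
  apply: contrapT => nos; apply: noD; exists i => s Ts.
  have [//|[k sk0]] := unitF (h s i); case: nos; exists (s ^+ k).
    by elim: k {sk0} => [|k IHk]; rewrite ?expr0 // exprS; apply: TM.
  by rewrite -[LHS]/((prod_proj i \o h) (s ^+ k)) rmorphXn.
suff [s Ts s0] : exists2 s, T s & forall i, i \in enum 'I_n -> h s i = 0.
  suff /injh s_eq0 : h s = 0 by rewrite s_eq0 in Ts.
  by apply/prod_eq0 => i; apply: s0; rewrite mem_enum.
elim: (enum 'I_n) => [|i l [s Ts s0]]; first by exists 1.
have [t Tt ti0] := vanish i; exists (t * s); first exact: TM.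
move=> j; rewrite inE rmorphM => /orP jl.
apply: (etrans (y := h t j * h s j)); first by [].
by case: jl => [/eqP->|/s0->]; rewrite ?ti0 ?mul0r ?mulr0.
Qed.

Lemma component_sub_eq i j : D i `<=` D j -> i = j.
Proof.
have [b ub b0] := component_separating i => /(_ b ub) /(is_unit_neq0 (oner_neq0 _)).
by have [//|ji] := eqVneq i j; rewrite /= /prod_proj b0 ?eqxx // eq_sym.
Qed.

(** Every denominator set lies in some [D i], and distinct [D i] are incomparable. *)
Lemma max_Den_components : max_Den R = [set D i | i in [set: 'I_n]].
Proof.
apply/seteqP; split=> [S [denS maxS]|_ [i _ <-]].
  have [i SD] := denominator_sub_component denS; exists i => //.
  exact: maxS (component_denominator i) SD.
split; first exact: component_denominator.
move=> T denT DT; have [j TD] := denominator_sub_component denT.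
have ij : i = j by apply: component_sub_eq => x /DT/TD.
by apply/seteqP; split=> //; rewrite {1}ij.
Qed.

Lemma components_weakly_localizable :
  [/\ weakly_left_localizable R,
      left_localization_radical R = [set 0],
      finite_set (max_Den R),
      (forall (S : set R) (denS : left_denominator S),
         max_Den R S -> weakly_left_localizable (left_localization denS))
    & (forall S T : set R, max_Den R S -> max_Den R T -> S <> T ->
         ~ nil_modulo (ass S) (ass T))].
Proof.
have locD i := component_left_localization_map i.
rewrite /left_localization_radical max_Den_components; split.
(* A non-localizable element is a unit in no component, hence nilpotent in each; the exponents are
   added over the components. *)
- move=> x nx; apply: contrapT => nlx; apply: nx.
  suff [k xk0] : exists k, forall i, i \in enum 'I_n -> (h x i) ^+ k = 0.
    exists k; apply: injh; rewrite rmorphXn; apply/prod_eq0 => i.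
    by rewrite -[LHS]/(prod_proj i (h x ^+ k)) rmorphXn xk0 // mem_enum.
  elim: (enum 'I_n) => [|i l [k xk0]]; first by exists 0%N.
  have [ux|[m xm0]] := unitF (h x i).
    by case: nlx; exists (D i) => //; apply: component_denominator.
  exists (k + m)%N => j; rewrite inE exprD => /orP[/eqP->|/xk0->].
    by rewrite xm0 mulr0.
  by rewrite mul0r.
- apply/seteqP; split=> [r r0|_ -> _ [i _ <-]].
    apply/injh/prod_eq0 => i; apply/(ass_unit_preimage (locD i)).
    by apply: r0; exists i.
  by apply/(ass_unit_preimage (locD i)); rewrite rmorph0.
- exact/finite_image/finite_finset.
- move=> S denS [i _ eS]; apply: unit_or_nilpotent_weakly_localizable.
  apply: (@unit_or_nilpotent_isomorphic _ (F i)) => //.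
  exact: left_localization_isomorphic (locD i) eS.
- move=> _ _ [i _ <-] [j _ <-] neq.
  (* [b] lies in [ass (D i)], but its powers stay units in component [j], so none lies in
     [ass (D j)]. *)
  have [b ub b0] := component_separating j => /(_ b 0)[].
  + apply/(ass_unit_preimage (locD i)); apply: b0.
    by apply/eqP => ij; apply: neq; rewrite ij.
  + by apply/(ass_unit_preimage (locD j)); rewrite rmorph0.
  + move=> k; rewrite addr0 => /(ass_unit_preimage (locD j)); rewrite rmorphXn.
    apply/eqP/is_unit_neq0; first exact: oner_neq0.
    exact: is_unitX.
Qed.

End Components.
End ProductMaps.

(** * From maximal denominator sets to the classical quotient ring *)

Lemma max_Den_product_of_local_rings (R : nzRingType) :
  left_localization_radical R = [set 0] ->
  finite_set (max_Den R) ->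
  (forall (S : set R) (denS : left_denominator S),
     max_Den R S -> weakly_left_localizable (left_localization denS)) ->
  (forall S T : set R, max_Den R S -> max_Den R T -> S <> T ->
     ~ nil_modulo (ass S) (ass T)) ->
  exists oreC : left_Ore (regular_elements R),
    product_of_local_rings (classical_left_quotient_ring oreC).
Proof.
(* Repetitions are removed from the list so that distinct indices give distinct maximal sets. *)
move=> rad0 /finite_seqP[l0 maxE] wll nnil.
pose l := undup l0; pose n := size l.
pose S (i : 'I_n) := tnth (in_tuple l) i.
have maxS i : max_Den R (S i).
  by rewrite maxE /= -mem_undup; apply: (mem_tnth i (in_tuple l)).
have maxSE T : max_Den R T -> exists i, T = S i.
  by rewrite maxE /= -mem_undup => /(tnthP (in_tuple l)).
have S_inj i j : S i = S j -> i = j.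
  by move/tuple_uniqP: (undup_uniq l0 : uniq (in_tuple l)) => /[apply].
have denS i : left_denominator (S i) by case: (maxS i).
pose F i : nzRingType := left_localization (denS i).
have unitF i : unit_or_nilpotent (F i).
  by apply: max_Den_unit_or_nilpotent => //; apply: wll.
pose f i : {rmorphism R -> F i} := loc_map (denS i).
have locf i : left_localization_map (f i) by apply: loc_map_left_localization_map.
have f0 i r : f i r = 0 <-> ass (S i) r by apply: loc_map_eq0.
have sepf i j : i != j -> exists2 x, f i x = 0 & is_unit (f j x).
  (* Without a separator, every element of [ass (S i)] is a nonunit in [F j], hence nilpotent there,
     against the last hypothesis. *)
  move=> ij; apply: contrapT => nox.
  apply: (nnil (S i) (S j)) => // [/S_inj/eqP|x y]; first by rewrite (negPf ij).
  move=> /f0 x0 /f0 y0; have [ux|[k xk0]] := unitF j (f j x).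
    by case: nox; exists x.
  by exists k; apply/f0; rewrite rmorphXn rmorphD y0 addr0.
have injf r : prod_map f r = 0 -> r = 0.
  move=> /prod_eq0 r0; suff : left_localization_radical R r by rewrite rad0.
  by move=> T /maxSE[i ->]; apply/f0/r0.
have locP := prod_left_localization_map locf sepf injf.
have n_gt0 : (0 < n)%N.
  (* With no maximal set, the intersection would be all of [R] and contain 1. *)
  rewrite lt0n; apply/eqP => n0.
  have : left_localization_radical R 1.
    by move=> T /maxSE[i _]; have := ltn_ord i; rewrite [X in (_ < X)%N]n0.
  by rewrite rad0 => /eqP; rewrite oner_eq0.
have unitC : unit_preimage (prod_map f) = regular_elements R.
  apply/seteqP; split=> [x [y [xy yx]] r|x regx].
    split=> xr; apply: injf.
      by rewrite -[LHS]mul1r -yx -mulrA -rmorphM xr rmorph0 mulr0.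
    by rewrite -[LHS]mulr1 -xy mulrA -rmorphM xr rmorph0 mul0r.
  (* If component [i] of [x] is nilpotent, some [s] in [S i] satisfies s x^k = 0; cancelling the
     regular [x] gives s = 0, which is excluded. *)
  apply/prod_is_unit => i; have [//|[k]] := unitF i (f i x).
  rewrite -rmorphXn => /f0[s Ss sx].
  suff s0 : s = 0 by case: (denS i) => -[_ +] _; rewrite -s0.
  elim: k sx => [|k IHk]; first by rewrite mulr1.
  by rewrite exprSr mulrA => /(regx _).2.
have denC : left_denominator (regular_elements R).
  rewrite -unitC; apply: unit_preimage_denominator locP.
  exact: (prod_ring_nontrivial F (Ordinal n_gt0)).
exists denC.1, n, F; split=> //.
- exact: left_localization_isomorphic locP unitC.
- by move=> i; have [] := (unit_or_nilpotentP (F i)).1 (unitF i).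
- by move=> i; have [] := (unit_or_nilpotentP (F i)).1 (unitF i).
Qed.

(** * Comparison of the two quotient rings, and the equivalence *)

Lemma largest_regular_denE (R : nzRingType) :
  left_Ore (regular_elements R) -> largest_regular_den R = regular_elements R.
Proof.
move=> oreC; apply/seteqP; split; first exact: largest_regular_den_regular.
apply: largest_regular_den_max; first exact: regular_left_Ore_denominator.
exact: regular_left_Ore_ass.
Qed.

(** The type of the localization depends on the proof [denS], so proof irrelevance is needed besides
    the equality of sets. *)
Lemma product_of_local_rings_eq (R : nzRingType) (S T : set R)
    (denS : left_denominator S) (denT : left_denominator T) : S = T ->
  product_of_local_rings (left_localization denS) ->
  product_of_local_rings (left_localization denT).
Proof. by move=> eST; subst T; rewrite (Prop_irrelevance denS denT). Qed.

Theorem theorem3p9 (R : nzRingType) :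
  [<-> [/\ weakly_left_localizable R,
           left_localization_radical R = [set 0],
           finite_set (max_Den R),
           (forall (S : set R) (denS : left_denominator S),
              max_Den R S -> weakly_left_localizable (left_localization denS))
         & (forall S T : set R, max_Den R S -> max_Den R T -> S <> T ->
              ~ nil_modulo (ass S) (ass T))];
       exists oreC : left_Ore (regular_elements R),
         product_of_local_rings (classical_left_quotient_ring oreC);
       product_of_local_rings (largest_left_quotient_ring R)].
Proof.
tfae.
- by move=> [_ rad0 fin wll nnil]; apply: max_Den_product_of_local_rings.
- by move=> [oreC]; apply: product_of_local_rings_eq; rewrite largest_regular_denE.
- move=> [n [F [_ [psi bijpsi] locF radF]]].
  pose lam := loc_map (largest_regular_den_denominator R).
  have unitF i : unit_or_nilpotent (F i) by apply/unit_or_nilpotentP.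
  have loch : left_localization_map (psi \o lam).
    apply: comp_left_localization_map.
      exact: loc_map_left_localization_map.
    exact: bijective_left_localization_map.
  (* The composite is injective because the denominators of Q_l(R) have zero [ass]. *)
  apply: (@components_weakly_localizable _ _ _ (psi \o lam)) => // r /= psi0.
  have /loc_map_eq0 : lam r = 0.
    by apply: (bij_inj bijpsi); rewrite psi0 rmorph0.
  by rewrite ass_largest_regular_den.
Qed.
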